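(* Let $\phi$ be an embedding of (an open subset of) $\mathbb{R}^n$ into $\mathbb{R}^r$ with $\phi(x_0)=y_0$, let $\Pi^s$ be the metric projection onto the image of $\phi$ near $y_0$, and let $\tilde\Pi^s=\phi^{-1}\circ\Pi^s$. Define $\tilde y^a=y^a-y_0^a$. Then to second order, for $1\le a\le n$, $$\tilde\Pi^s(y)^a=x_0^a+\Pi^a_\alpha\tilde y^\alpha-\tfrac12\frac{\partial^2\phi^\gamma}{\partial x^\alpha\partial x^\beta}\Pi^a_\gamma\Pi^\alpha_\delta\Pi^\beta_\epsilon\,\tilde y^\delta\tilde y^\epsilon+\frac{\partial^2\phi^\gamma}{\partial x^\alpha\partial x^\beta}\Pi^\beta_\delta h^{a\alpha}\,\tilde y^\gamma\tilde y^\delta-\frac{\partial^2\phi^\gamma}{\partial x^\alpha\partial x^\beta}\Pi^\beta_\epsilon\Pi^\eta_\gamma\Pi^\zeta_\delta h_{\eta\zeta}h^{a\alpha}\,\tilde y^\delta\tilde y^\epsilon+O(|\tilde y|^3),$$ where the derivatives of $\phi$, $h$ and $\Pi$ are evaluated at $x_0$.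
   Context: The Einstein convention is extended: an index appearing twice in a product is summed, over the smaller of the ranges ($1..n$ or $1..r$) to which it may belong (regardless of whether both occurrences are upper). Indices referring to $x\in\mathbb{R}^n$ run over $1..n$ and components in $\mathbb{R}^r$ over $1..r$. Define $$h_{ab}=\sum_{\alpha=1}^r\frac{\partial\phi^\alpha}{\partial x^a}\frac{\partial\phi^\alpha}{\partial x^b}\ (1\le a,b\le n),\qquad (h^{ab})=(h_{ab})^{-1},\qquad \Pi^a_b=\sum_{\alpha=1}^n\frac{\partial\phi^b}{\partial x^\alpha}h^{a\alpha}\ (a\le n,\ b\le r).$$ The metric projection $\Pi^s$ sends a point of a tubular neighbourhood in $\mathbb{R}^r$ to the nearest point of the submanifold. *)

(* Defs.v *)
From HB Require Import structures.
From mathcomp Require Import all_boot all_order all_algebra.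
From mathcomp Require Import all_classical all_reals all_analysis.

Set Implicit Arguments.
Unset Strict Implicit.
Unset Printing Implicit Defensive.

Import Order.TTheory GRing.Theory Num.Theory.
Import numFieldNormedType.Exports.

Local Open Scope classical_set_scope.
Local Open Scope ring_scope.

(* The library norm on 'rV[R]_m is the sup norm; nearest points have to be
   taken for the Euclidean one. *)
Definition enorm (R : realType) (m : nat) (v : 'rV[R]_m) : R :=
  Num.sqrt (\sum_(i < m) v 0 i ^+ 2).

Definition partial (R : realType) (n : nat) (W : normedModType R) (a : 'I_n)
    (f : 'rV[R]_n -> W) : 'rV[R]_n -> W :=
  fun x => 'D_(delta_mx 0 a) f x.

Fixpoint Ck_on (R : realType) (n : nat) (W : normedModType R) (k : nat)
    (U : set 'rV[R]_n) (f : 'rV[R]_n -> W) : Prop :=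
  if k is k'.+1 then
    (forall x, U x -> differentiable f x) /\
    (forall a : 'I_n, Ck_on k' U (partial a f))
  else forall x, U x -> {for x, continuous f}.

Definition smooth_on (R : realType) (n : nat) (W : normedModType R)
    (U : set 'rV[R]_n) (f : 'rV[R]_n -> W) : Prop :=
  forall k, Ck_on k U f.

(* A smooth embedding of the open set U: an injective immersion that is a
   homeomorphism onto its image. Only the values of phi on U matter, and
   [pinv U phi] is phi^-1 : phi(U) -> U, with junk values outside phi(U). *)
Definition embedding_on (R : realType) (n r : nat) (U : set 'rV[R]_n)
    (phi : 'rV[R]_n -> 'rV[R]_r) : Prop :=
  [/\ smooth_on U phi,
      forall x, U x -> injective ('d phi x),
      {in U &, injective phi} &
      {within phi @` U, continuous (pinv U phi)}].

Definition metric_projection_on (R : realType) (r : nat)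
    (M V : set 'rV[R]_r) (P : 'rV[R]_r -> 'rV[R]_r) : Prop :=
  forall y, V y ->
    M (P y) /\ forall z, M z -> z != P y -> enorm (P y - y) < enorm (z - y).

Definition component (R : realType) (n r : nat) (phi : 'rV[R]_n -> 'rV[R]_r)
    (g : 'I_r) : 'rV[R]_n -> R :=
  fun x => phi x 0 g.

(* hmx a b = h_ab, hinv a b = h^ab and Pimx a b = Pi^a_b; hmx is invertible
   wherever phi is an immersion, so that [invmx] is then a true inverse. *)
Definition hmx (R : realType) (n r : nat) (phi : 'rV[R]_n -> 'rV[R]_r)
    (x : 'rV[R]_n) : 'M[R]_n :=
  \matrix_(a, b) \sum_(al < r)
    partial a (component phi al) x * partial b (component phi al) x.

Definition hinv (R : realType) (n r : nat) (phi : 'rV[R]_n -> 'rV[R]_r)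
    (x : 'rV[R]_n) : 'M[R]_n := invmx (hmx phi x).

Definition Pimx (R : realType) (n r : nat) (phi : 'rV[R]_n -> 'rV[R]_r)
    (x : 'rV[R]_n) : 'M[R]_(n, r) :=
  \matrix_(a, b) \sum_(al < n) partial al (component phi b) x * hinv phi x a al.

(* Main.v *)
Require Import Defs.
From HB Require Import structures.
From mathcomp Require Import all_boot all_order all_algebra.
From mathcomp Require Import all_classical all_reals all_analysis.
From mathcomp Require Import ring lra.

Set Implicit Arguments.
Unset Strict Implicit.
Unset Printing Implicit Defensive.

Import Order.TTheory GRing.Theory Num.Theory.
Import numFieldNormedType.Exports.

Local Open Scope classical_set_scope.
Local Open Scope ring_scope.

(** Put [x = tPis y], [u = x - x0] and [t = y - y0]. As [phi x] minimises the
distance to [y] over the image of the open set [U], it is a critical point: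
for every [b],
  sum_g (phi^g x - y^g) * d_b phi^g x = 0.
Write [J] for the first derivatives of [phi] at [x0] and [H] for the second
ones. Taylor expansion turns this into
  sum_g (J_g u - t_g) J_gb + normal_quad b u t = O(3),
where [normal_quad] collects the terms of degree two in [(u, t)]. Multiplying
by the inverse [h'] of the Gram matrix [h = J^T J] solves the linear part:
  u - Pi t + h' normal_quad u t = O(3).
So [u = Pi t] up to order two, and replacing [u] by [Pi t] in the quadratic
term costs only order three. What remains is the expansion of
[x0 + Pi t - h' normal_quad (Pi t) t] into the sums of the statement, where
[sum_et Pi_et,g h_et,ze = J_g,ze] explains the last one.

Everything rests on [u = O(t)]. The projection at most doubles the Euclidean
distance to [y0] ([metric_projection_lipschitz]), so [Pis y] tends to [y0] and,
the inverse chart being continuous, [x] tends to [x0]; near [x0] an immersion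
is bounded below ([immersion_lower_bound]).

The expansion of [d_b phi^g] produces the second derivatives in the order
opposite to that of the statement, so their symmetry ([schwarz]) is part of
the argument. Orders of magnitude are handled by the predicate [vanishes],
which is stable under sums, products and composition with [tPis]; Taylor
expansions come from the mean value theorem on segments, each integration
raising the order by one ([vanishes_primitive]). *)

(** * The Euclidean norm and the sup norm *)

Lemma normr_coord_le (R : realType) (m : nat) (v : 'rV[R]_m) (i : 'I_m) :
  `|v 0 i| <= `|v|.
Proof.
rewrite [leRHS]/Num.Def.normr/= mx_normrE.
exact: (le_bigmax _ (fun ij : 'I_1 * 'I_m => `|v ij.1 ij.2|) (ord0, i)).
Qed.

Lemma normr_coords_le (R : realType) (m : nat) (v : 'rV[R]_m) (c : R) :
  0 <= c -> (forall i, `|v 0 i| <= c) -> `|v| <= c.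
Proof.
move=> c0 vc; rewrite [leLHS]/Num.Def.normr/= mx_normrE.
by apply: bigmax_le => //= -[i j] _ /=; rewrite ord1.
Qed.

Lemma enorm_sqr (R : realType) (m : nat) (v : 'rV[R]_m) :
  enorm v ^+ 2 = \sum_(i < m) v 0 i ^+ 2.
Proof. by rewrite sqr_sqrtr// sumr_ge0// => i _; exact: sqr_ge0. Qed.

Lemma normr_le_enorm (R : realType) (m : nat) (v : 'rV[R]_m) : `|v| <= enorm v.
Proof.
apply: normr_coords_le => [|i]; first exact: sqrtr_ge0.
rewrite -sqrtr_sqr ler_wsqrtr// (bigD1 i)//= lerDl.
by rewrite sumr_ge0// => j _; exact: sqr_ge0.
Qed.

Lemma enorm_le_normr (R : realType) (m : nat) (v : 'rV[R]_m) :
  enorm v <= Num.sqrt m%:R * `|v|.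
Proof.
rewrite -[`|v|]ger0_norm// -sqrtr_sqr -sqrtrM// ler_wsqrtr//.
rewrite mulr_natl -[X in _ *+ X]card_ord -sumr_const ler_sum// => i _.
by rewrite -real_normK ?num_real// ler_sqr ?nnegrE// normr_coord_le.
Qed.

(** * Orders of vanishing *)

Definition vanishes (R : realType) (m : nat) (p : 'rV[R]_m) (k : nat)
    (f : 'rV[R]_m -> R) : Prop :=
  f =O_p (fun x => `|x - p| ^+ k).

Lemma vanishesP (R : realType) (m : nat) (p : 'rV[R]_m) (k : nat)
    (f : 'rV[R]_m -> R) :
  vanishes p k f <->
  exists2 C, 0 < C & \forall x \near p, `|f x| <= C * `|x - p| ^+ k.
Proof.
split=> [/eqO_exP[C C0 H]|[C C0 H]].
  by exists C => //; apply: filterS H => x; rewrite normrX normr_id.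
apply/eqO_exP; exists C => //.
by apply: filterS H => x; rewrite normrX normr_id.
Qed.

Section vanishes_theory.
Context {R : realType} {m : nat} (p : 'rV[R]_m).
Implicit Types (f g : 'rV[R]_m -> R) (k l : nat).

Lemma vanishes_near k f g :
  (\forall x \near p, f x = g x) -> vanishes p k g -> vanishes p k f.
Proof.
move=> fg /vanishesP[C C0 H]; apply/vanishesP; exists C => //.
by apply: filterS2 fg H => x ->.
Qed.

Lemma vanishes_ext k f g : f =1 g -> vanishes p k g -> vanishes p k f.
Proof. by move=> fg vg; apply: vanishes_near vg; exact: filterE. Qed.

Lemma vanishesD k f g : vanishes p k f -> vanishes p k g ->
  vanishes p k (fun x => f x + g x).
Proof.
move=> /vanishesP[C C0 fC] /vanishesP[D D0 gD]; apply/vanishesP.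
exists (C + D); first exact: addr_gt0.
apply: filterS2 fC gD => x fx gx.
by rewrite (le_trans (ler_normD _ _))// mulrDl lerD.
Qed.

Lemma vanishes_sum k (I : finType) (F : I -> 'rV[R]_m -> R) :
  (forall i, vanishes p k (F i)) -> vanishes p k (fun x => \sum_i F i x).
Proof.
move=> HF; elim: (index_enum I) => [|i s IH].
  apply/vanishesP; exists 1 => //; apply: filterE => x.
  by rewrite big_nil normr0 mul1r exprn_ge0.
apply: vanishes_ext (vanishesD (HF i) IH) => x.
by rewrite big_cons.
Qed.

Lemma vanishesM k l f g : vanishes p k f -> vanishes p l g ->
  vanishes p (k + l) (fun x => f x * g x).
Proof.
move=> /vanishesP[C C0 fC] /vanishesP[D D0 gD]; apply/vanishesP.
exists (C * D); first exact: mulr_gt0.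
apply: filterS2 fC gD => x fx gx.
by rewrite normrM exprD mulrACA ler_pM.
Qed.

Lemma vanishes_cst (c : R) : vanishes p 0 (fun=> c).
Proof.
apply/vanishesP; exists (`|c| + 1); first by rewrite ltr_wpDl.
by apply: filterE => x; rewrite expr0 mulr1 lerDl.
Qed.

Lemma vanishesZ k (c : R) f : vanishes p k f -> vanishes p k (fun x => c * f x).
Proof. by move=> /(vanishesM (vanishes_cst c)). Qed.

Lemma vanishesN k f : vanishes p k f -> vanishes p k (fun x => - f x).
Proof.
move=> /(vanishesZ (-1)); apply: vanishes_ext => x.
by rewrite mulN1r.
Qed.

Lemma vanishesB k f g : vanishes p k f -> vanishes p k g ->
  vanishes p k (fun x => f x - g x).
Proof. by move=> Hf /vanishesN; exact: vanishesD. Qed.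

Lemma vanishesW k l f : (k <= l)%N -> vanishes p l f -> vanishes p k f.
Proof.
move=> kl /vanishesP[C C0 H]; apply/vanishesP; exists C => //.
have p1 : \forall x \near p, `|x - p| <= 1.
  near=> x; rewrite distrC; near: x.
  exact: (@cvgr_dist_le _ _ _ _ _ id p).
apply: filterS2 p1 H => x x1 /le_trans; apply.
by rewrite ler_wpM2l ?(ltW C0)// ler_wiXn2l.
Unshelve. all: by end_near. Qed.

Lemma vanishes_coord (i : 'I_m) : vanishes p 1 (fun x => (x - p) 0 i).
Proof.
apply/vanishesP; exists 1 => //; apply: filterE => x.
by rewrite expr1 mul1r normr_coord_le.
Qed.

Lemma vanishes_cvg (n : nat) (q : 'rV[R]_n) (g : 'rV[R]_m -> 'rV[R]_n) :
  vanishes p 1 (fun x => `|g x - q|) -> g x @[x --> p] --> q.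
Proof.
move=> /vanishesP[C C0 H]; apply/(@cvgrPdist_le _ _ _ (nbhs p)) => e e0.
have pe := nbhsx_ballx p (e / C) (divr_gt0 e0 C0).
apply: filterS2 H pe => x; rewrite normr_id expr1 distrC -ball_normE/=.
by move=> /le_trans + /ltW xp; apply; rewrite mulrC -ler_pdivlMr// distrC.
Qed.

(** A first order bound on [g] is enough to pull back any order of vanishing,
so [g] may be known no better than Lipschitz at [p]. *)
Lemma vanishes_comp (n : nat) (q : 'rV[R]_n) (g : 'rV[R]_m -> 'rV[R]_n)
    (f : 'rV[R]_n -> R) k :
  vanishes p 1 (fun x => `|g x - q|) ->
  vanishes q k f -> vanishes p k (f \o g).
Proof.
move=> g1 /vanishesP[D D0 fD]; have gq := vanishes_cvg g1.
have /vanishesP[C C0 gC] := g1; apply/vanishesP.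
exists (D * C ^+ k); first by rewrite mulr_gt0// exprn_gt0.
apply: filterS2 gC (gq _ fD) => x /= gx /le_trans; apply.
rewrite -mulrA ler_wpM2l ?(ltW D0)// -exprMn lerXn2r ?nnegrE//.
  by rewrite mulr_ge0// ltW.
by move: gx; rewrite normr_id expr1.
Qed.

End vanishes_theory.

(** * Mean value estimates and Taylor expansions *)

Lemma derive_partial (R : realType) (n : nat) (W : normedModType R)
    (f : 'rV[R]_n -> W) (x u : 'rV[R]_n) :
  differentiable f x -> 'D_u f x = \sum_(a < n) u 0 a *: partial a f x.
Proof.
move=> df; rewrite deriveE// [in LHS](row_sum_delta u) linear_sum/=.
by apply: eq_bigr => a _; rewrite linearZ/= /partial deriveE.
Qed.

Lemma is_derive_segment (R : realType) (n : nat) (f : 'rV[R]_n -> R)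
    (x u : 'rV[R]_n) (t : R) :
  differentiable f (x + t *: u) ->
  is_derive t 1 (fun s : R => f (x + s *: u)) ('D_u f (x + t *: u)).
Proof.
move=> df.
have du : is_diff t (fun s : R => x + s *: u) (fun s => s *: u).
  by apply: is_diff_eq; rewrite funeqE => s /=; rewrite add0r.
have dfu : differentiable (f \o (fun s : R => x + s *: u)) t.
  exact: differentiable_comp.
apply: DeriveDef; first by apply/derivable1_diffP; exact: dfu.
rewrite deriveE; last exact: dfu.
rewrite (_ : (fun s => _) = f \o (fun s => x + s *: u))// diff_comp//=.
by rewrite diff_val scale1r deriveE.
Qed.

(** Bounding the derivative of the difference [f (x + t *: u) - p t] along the
segment, the mean value theorem bounds its increment. *)
Lemma segment_estimate (R : realType) (n : nat) (f : 'rV[R]_n -> R)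
    (x u : 'rV[R]_n) (p dp : R -> R) (M : R) :
  (forall t : R, t \in `[0, 1] -> differentiable f (x + t *: u)) ->
  (forall t : R, is_derive t 1 p (dp t)) ->
  (forall t : R, t \in `]0, 1[ -> `|'D_u f (x + t *: u) - dp t| <= M) ->
  `|f (x + u) - f x - (p 1 - p 0)| <= M.
Proof.
move=> df hp hM.
pose k (t : R) := f (x + t *: u) - p t.
have dk (t : R) : t \in `[0, 1] -> is_derive t 1 k ('D_u f (x + t *: u) - dp t).
  move=> t01; have ? := is_derive_segment (df _ t01); have ? := hp t.
  exact: is_deriveB.
have ck : {within `[0, 1], continuous k}.
  apply: derivable_within_continuous => t t01.
  by have ? := dk _ t01; exact: ex_derive.
have dk' (t : R) : t \in `]0, 1[ ->
    is_derive t 1 k ('D_u f (x + t *: u) - dp t).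
  by move=> t01; apply: dk; apply: subset_itv_oo_cc.
have [c c01] := MVT ltr01 dk' ck.
rewrite /k scale1r scale0r addr0 subr0 mulr1 => E.
rewrite (_ : _ - _ = 'D_u f (x + c *: u) - dp c) ?hM//.
by rewrite -E; ring.
Qed.

(** Integration raises the order of vanishing by one: if each partial
derivative of [f] agrees with [L a] to order [k], and [P] is a primitive of
the [L a] along the rays from [x0], then [f] agrees with [P] to order
[k.+1]. *)
Lemma vanishes_primitive (R : realType) (n : nat) (f P : 'rV[R]_n -> R)
    (L : 'I_n -> 'rV[R]_n -> R) (x0 : 'rV[R]_n) (k : nat) :
  (\forall x \near x0, differentiable f x) ->
  (forall a, vanishes x0 k (fun x => partial a f x - L a (x - x0))) ->
  (forall u (t : R), is_derive t 1 (fun s : R => P (s *: u))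
    (\sum_(a < n) u 0 a * L a (t *: u))) ->
  vanishes x0 k.+1 (fun x => f x - f x0 - (P (x - x0) - P 0)).
Proof.
move=> df HL dP.
have /all_sig2[C C0 HC] :
    forall a, {C | 0 < C & \forall x \near x0,
      `|partial a f x - L a (x - x0)| <= C * `|x - x0| ^+ k}.
  by move=> a; apply: cid2; apply/vanishesP.
have {}HC : \forall x \near x0, forall a,
    `|partial a f x - L a (x - x0)| <= C a * `|x - x0| ^+ k.
  exact: (@filter_forall _ _ (fun a x =>
    `|partial a f x - L a (x - x0)| <= C a * `|x - x0| ^+ k) (nbhs x0)).
have [e /= e0 He] := (nbhs_ballP _ _).1 (filterI df HC).
(* the summand 1 keeps the constant positive when [n] is 0 *)
apply/vanishesP; exists (1 + \sum_(a < n) C a).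
  by rewrite ltr_pwDl// sumr_ge0// => a _; exact: ltW.
apply/nbhs_ballP; exists e => //= x x0x.
set u := x - x0.
have segm (t : R) : t \in `[0, 1] -> ball x0 e (x0 + t *: u).
  rewrite in_itv/= => /andP[t0 t1].
  rewrite -ball_normE/= opprD addrA subrr sub0r normrN normrZ ger0_norm//.
  rewrite (le_lt_trans (ler_piMl _ _))//.
  by move: x0x; rewrite -ball_normE/= distrC.
have := @segment_estimate R n f x0 u (fun s : R => P (s *: u))
  (fun t : R => \sum_(a < n) u 0 a * L a (t *: u))
  ((1 + \sum_(a < n) C a) * `|u| ^+ k.+1).
rewrite scale1r scale0r /u subrKC -/u; apply => //.
  by move=> t /segm/He[].
move=> t /subset_itv_oo_cc t01; have [dft HCt] := He _ (segm _ t01).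
rewrite derive_partial// -sumrB (le_trans (ler_norm_sum _ _ _))//.
rewrite exprS mulrDl mul1r ler_wpDl// ?mulr_ge0//.
rewrite mulr_suml ler_sum// => a _.
rewrite [_ *: _]/(_ * _) -mulrBr normrM mulrCA ler_pM// ?normr_coord_le//.
have := HCt a; rewrite addrAC subrr add0r => /le_trans; apply.
rewrite ler_wpM2l ?(ltW (C0 a))// lerXn2r ?nnegrE// normrZ.
move: t01; rewrite in_itv/= => /andP[t0 t1].
by rewrite ger0_norm// ler_piMl.
Qed.

Lemma vanishes_diff (R : realType) (n : nat) (f : 'rV[R]_n -> R)
    (x0 : 'rV[R]_n) :
  differentiable f x0 -> vanishes x0 1 (fun x => f x - f x0).
Proof.
move=> df; have /diffP[dfc _] := df.
have [k k0 Hk] := linear_lipschitz dfc.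
have /eqaddoP/(_ _ ltr01) := diff_locally df.
rewrite /= => H; apply/vanishesP; exists (k + 1); first exact: addr_gt0.
rewrite (near_shift 0) /=; apply: filterS H => h.
rewrite subr0 /= addrK mul1r expr1 => H.
rewrite (_ : f _ - _ = (f \o shift x0 - (cst (f x0) + 'd f x0)) h + 'd f x0 h).
  by rewrite (le_trans (ler_normD _ _))// addrC mulrDl mul1r lerD.
by rewrite !fctE /=; ring.
Qed.

Lemma taylor1 (R : realType) (n : nat) (f : 'rV[R]_n -> R) (x0 : 'rV[R]_n) :
  (\forall x \near x0, differentiable f x) ->
  (forall a, differentiable (partial a f) x0) ->
  vanishes x0 2
    (fun x => f x - f x0 - \sum_(a < n) (x - x0) 0 a * partial a f x0).
Proof.
move=> df d2f; pose P (u : 'rV[R]_n) := \sum_(a < n) u 0 a * partial a f x0.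
have P0 : P 0 = 0 by apply: big1 => a _; rewrite mxE mul0r.
have := @vanishes_primitive R n f P (fun a _ => partial a f x0) x0 1 df.
under eq_fun do rewrite P0 subr0; apply.
  by move=> a; exact: vanishes_diff.
move=> u t.
rewrite (_ : (fun s => _) = (fun s => s * P u)).
  by apply: is_derive_eq; rewrite scaler0 add0r [LHS]mulr1.
apply/funext => s; rewrite mulr_sumr; apply: eq_bigr => a _.
by rewrite mxE mulrA.
Qed.

Lemma taylor2 (R : realType) (n : nat) (f : 'rV[R]_n -> R) (x0 : 'rV[R]_n) :
  (\forall x \near x0, differentiable f x) ->
  (forall a, \forall x \near x0, differentiable (partial a f) x) ->
  (forall a b, differentiable (partial b (partial a f)) x0) ->
  vanishes x0 3
    (fun x => f x - f x0 - (\sum_(a < n) (x - x0) 0 a * partial a f x0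
      + 2^-1 * \sum_(a < n) \sum_(b < n)
          (x - x0) 0 a * (x - x0) 0 b * partial b (partial a f) x0)).
Proof.
move=> df d2f d3f.
pose P1 (u : 'rV[R]_n) := \sum_(a < n) u 0 a * partial a f x0.
pose P2 (u : 'rV[R]_n) :=
  \sum_(a < n) \sum_(b < n) u 0 a * u 0 b * partial b (partial a f) x0.
pose P u := P1 u + 2^-1 * P2 u.
have P0 : P 0 = 0.
  rewrite /P /P1 /P2 !big1 ?mulr0 ?addr0// => a _; last by rewrite mxE mul0r.
  by rewrite big1// => b _; rewrite !mxE !mul0r.
have := @vanishes_primitive R n f P (fun a u => partial a f x0
  + \sum_(b < n) u 0 b * partial b (partial a f) x0) x0 2 df.
under eq_fun do rewrite P0 subr0; apply.
  move=> a; apply: vanishes_ext (taylor1 (d2f a) (d3f a)) => x.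
  by rewrite opprD addrA.
move=> u t.
rewrite (_ : (fun s => _) = (fun s => s * P1 u + 2^-1 * (s * s) * P2 u)).
  apply: is_derive_eq; rewrite /GRing.scale/= !mulr0 !add0r !mulr1.
  rewrite (_ : P2 u * _ = t * P2 u); last by field.
  rewrite mulr_sumr -big_split/=; apply: eq_bigr => a _.
  rewrite mulrDr; congr (_ + _); rewrite !mulr_sumr; apply: eq_bigr => b _.
  by rewrite mxE; ring.
apply/funext => s; rewrite /P /P1 /P2; congr (_ + _).
  by rewrite mulr_sumr; apply: eq_bigr => a _; rewrite mxE mulrA.
rewrite -mulrA; congr (_ * _); rewrite !mulr_sumr; apply: eq_bigr => a _.
by rewrite mulr_sumr; apply: eq_bigr => b _; rewrite !mxE; ring.
Qed.

(** * Symmetry of second derivatives *)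

Lemma derive_translate (R : realType) (n : nat) (f : 'rV[R]_n -> R)
    (c x u : 'rV[R]_n) :
  'D_u (fun z => f (z + c)) x = 'D_u f (x + c).
Proof.
rewrite /derive (_ : (fun h => _) =
  (fun h => h^-1 *: ((f \o shift (x + c)) (h *: u) - f (x + c))))//.
by apply/funext => h /=; rewrite addrA.
Qed.

Lemma differentiable_translate (R : realType) (n : nat) (f : 'rV[R]_n -> R)
    (c x : 'rV[R]_n) :
  differentiable f (x + c) -> differentiable (fun z => f (z + c)) x.
Proof.
move=> df; have dc : differentiable (fun z : 'rV[R]_n => z + c) x by [].
exact: (differentiable_comp dc).
Qed.

(** The second difference of [f] over the parallelogram spanned by [s *: v]
and [s *: w] is, by the mean value theorem in the direction [v], an increment
of ['D_v f] in the direction [w]. *)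
Lemma second_difference (R : realType) (n : nat) (f : 'rV[R]_n -> R)
    (x v w : 'rV[R]_n) (e : R) :
  (\forall y \near x, differentiable f y) -> differentiable ('D_v f) x ->
  0 < e -> \forall s \near 0^'+,
    `|f (x + s *: w + s *: v) - f (x + s *: w) - (f (x + s *: v) - f x)
      - s ^+ 2 * 'D_w ('D_v f) x| <= e * s ^+ 2.
Proof.
move=> df dvf e0.
(* [s * c] bounds the size of the parallelogram, and [e' * (s * c)] the error
   in the differential of ['D_v f] at each of the two ends of a [w]-side *)
pose c := `|v| + `|w| + 1.
have c0 : 0 < c by rewrite ltr_wpDl// addr_ge0.
pose e' := e / (2 * c); have e'0 : 0 < e' by rewrite divr_gt0// mulr_gt0.
have /eqaddoP/(_ _ e'0) := diff_locally dvf.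
rewrite /= => H.
have {}H : \forall y \near x,
    `|'D_v f y - 'D_v f x - 'd ('D_v f) x (y - x)| <= e' * `|y - x|.
  rewrite (near_shift 0) /=; apply: filterS H => h; rewrite subr0 /= addrK.
  rewrite !fctE/= => H; apply: le_trans H.
  by rewrite opprD addrA.
have [d /= d0 Hd] := (nbhs_ballP _ _).1 (filterI df H).
near=> s.
have s0 : 0 < s by near: s; exact: nbhs_right_gt.
have sd : s * c < d.
  by rewrite -ltr_pdivlMr//; near: s; apply: nbhs_right_lt; rewrite divr_gt0.
have par (t q : R) : 0 <= t <= 1 -> 0 <= q <= 1 ->
    `|q *: (s *: w) + t *: (s *: v)| <= s * c.
  move=> /andP[t0 t1] /andP[q0 q1].
  rewrite (le_trans (ler_normD _ _))// !normrZ !ger0_norm// ?(ltW s0)//.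
  rewrite /c mulrDr mulr1 ler_wpDr ?(ltW s0)// addrC mulrDr.
  by rewrite lerD// ler_piMl// mulr_ge0// ltW.
have parB (t q : R) : 0 <= t <= 1 -> 0 <= q <= 1 ->
    ball x d (x + q *: (s *: w) + t *: (s *: v)).
  move=> Ht Hq; rewrite -ball_normE/= -addrA opprD addrA subrr sub0r normrN.
  by rewrite (le_lt_trans _ sd)// par.
have i01 (t : R) : t \in `[0, 1] -> 0 <= t <= 1 by rewrite in_itv.
have sc y : differentiable f y -> 'D_(s *: v) f y = s * 'D_v f y.
  by move=> dy; rewrite (deriveE _ dy) linearZ/= -(deriveE _ dy).
pose k (z : 'rV[R]_n) := f (z + s *: w) - f z.
have kE z : differentiable f z -> differentiable f (z + s *: w) ->
    differentiable k z /\
    'D_(s *: v) k z = s * ('D_v f (z + s *: w) - 'D_v f z).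
  move=> dz dzw; have dfw := differentiable_translate dzw.
  split; first exact: differentiableB.
  rewrite deriveB; [|exact: diff_derivable|exact: diff_derivable].
  by rewrite derive_translate !sc// mulrBr.
pose A := s ^+ 2 * 'D_w ('D_v f) x.
suff : `|k (x + s *: v) - k x - (1 * A - 0 * A)| <= e * s ^+ 2.
  congr (`|_| <= _); rewrite /k mul1r mul0r subr0 (addrAC x (s *: v)) /A.
  by ring.
apply: (@segment_estimate _ _ _ _ _ (fun t => t * A) (fun=> A)).
- move=> t /i01 t01; have [||//] := kE (x + t *: (s *: v)).
    by have := parB t 0 t01; rewrite scale0r addr0 lexx ler01 => /(_ isT)/Hd[].
  rewrite addrAC -[s *: w]scale1r.
  by have := parB t 1 t01; rewrite lexx ler01 => /(_ isT)/Hd[].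
- by move=> t; apply: is_derive_eq; rewrite scaler0 add0r [LHS]mulr1.
move=> t /subset_itv_oo_cc/i01 t01.
have := parB t 1 t01; rewrite scale1r lexx ler01 => /(_ isT)/Hd[d1].
have := parB t 0 t01; rewrite scale0r addr0 lexx ler01 => /(_ isT)/Hd[d0'].
set y2 := x + t *: (s *: v); rewrite addrAC -/y2 in d1 *; set y1 := y2 + s *: w.
move=> H2 H1.
have [_ ->] := kE y2 d0' d1.
have E : s * 'D_w ('D_v f) x = 'd ('D_v f) x (y1 - x) - 'd ('D_v f) x (y2 - x).
  rewrite -linearB/= opprB addrA subrK /y1 addrAC subrr add0r.
  by rewrite linearZ/= deriveE.
rewrite -/y1 /A expr2 -mulrA -mulrBr E normrM gtr0_norm// mulrCA.
rewrite ler_wpM2l ?(ltW s0)//.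
rewrite (_ : _ - _ = ('D_v f y1 - 'D_v f x - 'd ('D_v f) x (y1 - x)) -
  ('D_v f y2 - 'D_v f x - 'd ('D_v f) x (y2 - x))); last by ring.
rewrite (le_trans (ler_normB _ _))//.
rewrite (_ : e * s = e' * (s * c) + e' * (s * c)); last first.
  by rewrite /e'; field; rewrite gt_eqF.
have ps q : 0 <= q <= 1 -> `|q *: (s *: w) + t *: (s *: v)| <= s * c.
  exact: par.
apply: lerD; [apply: le_trans H1 _|apply: le_trans H2 _];
  rewrite ler_wpM2l ?(ltW e'0)//.
  have := ps 1; rewrite scale1r lexx ler01 => /(_ isT); congr (`|_| <= _).
  by rewrite /y1 /y2 -(addrA x) [x + _]addrC addrK addrC.
have := ps 0; rewrite scale0r add0r lexx ler01 => /(_ isT); congr (`|_| <= _).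
by rewrite /y2 [x + _]addrC addrK.
Unshelve. all: by end_near. Qed.

(** The second difference is symmetric in [v] and [w]; dividing by [s ^+ 2]
identifies the two mixed derivatives up to any [e]. *)
Lemma schwarz (R : realType) (n : nat) (f : 'rV[R]_n -> R)
    (x v w : 'rV[R]_n) :
  (\forall y \near x, differentiable f y) ->
  differentiable ('D_v f) x -> differentiable ('D_w f) x ->
  'D_w ('D_v f) x = 'D_v ('D_w f) x.
Proof.
move=> df dv dw; apply/eqP; rewrite -subr_eq0 -normr_le0.
apply/ler_addgt0Pr => e e0; rewrite add0r.
have e20 : 0 < e / 2 by rewrite divr_gt0.
have [s [s0 [H1 H2]]] := filter_ex (filterI (nbhs_right_gt (0 : R))
  (filterI (second_difference w df dv e20) (second_difference v df dw e20))).
move: H1 H2; rewrite (addrAC x (s *: w)).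
move: ('D_w ('D_v f) x) ('D_v ('D_w f) x) => P Q.
move: (f (x + s *: v + s *: w)) (f (x + s *: w)) (f (x + s *: v)) (f x).
move=> A B C E H1 H2.
have {}s0 : 0 < s ^+ 2 by rewrite exprn_gt0.
rewrite -(ler_pM2l s0) -[in leLHS](gtr0_norm s0) -normrM.
rewrite (_ : s ^+ 2 * (P - Q) = (A - C - (B - E) - s ^+ 2 * Q) -
  (A - B - (C - E) - s ^+ 2 * P)); last by ring.
rewrite (le_trans (ler_normB _ _))// [s ^+ 2 * e]mulrC [e]splitr mulrDl.
exact: lerD H2 H1.
Qed.

(** * Differentiability of the components *)

Lemma near_eq_differentiable (R : realType) (V W : normedModType R)
    (f g : V -> W) (x : V) :
  {near x, f =1 g} -> differentiable f x -> differentiable g x.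
Proof.
move=> fg df; have dfc := diff_continuous df.
have Eg : g \o shift x = cst (g x) + 'd f x +o_ 0 id.
  apply/eqaddoP => _/posnumP[e].
  have /eqaddoP/(_ _ [gt0 of e%:num]) := diff_locally df.
  move: fg; rewrite /= (near_shift 0) subr0 /= => fg.
  have fgx : f x = g x by have := nbhs_singleton fg; rewrite /= add0r.
  apply: filterS2 fg => h /=.
  by rewrite !fctE /= fgx => ->.
apply/diff_locallyP; rewrite (diff_unique dfc Eg).
by split.
Qed.

(** The partial derivatives of a component of [phi] are the components of the
partial derivatives only where [phi] is differentiable, so [Ck_on] has to be
transported between functions that agree on [U] alone. *)
Lemma Ck_on_ext (R : realType) (n : nat) (W : normedModType R) (k : nat)
    (U : set 'rV[R]_n) (f g : 'rV[R]_n -> W) :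
  open U -> {in U, f =1 g} -> Ck_on k U f -> Ck_on k U g.
Proof.
move=> Uo.
have near_eq (f1 g1 : 'rV[R]_n -> W) x :
    {in U, f1 =1 g1} -> U x -> {near x, f1 =1 g1}.
  move=> fg Ux; apply: filterS (open_nbhs_nbhs (conj Uo Ux)) => y Uy.
  by apply: fg; rewrite inE.
elim: k f g => [|k IH] f g fg /=.
  move=> cf x Ux; have fgx := near_eq _ _ x fg Ux.
  rewrite /prop_for /continuous_at -(nbhs_singleton fgx).
  apply: cvg_trans (cf x Ux).
  apply: (@near_eq_cvg _ _ (nbhs x) _ f g fgx).
move=> [df Cf]; split=> [x Ux|a].
  exact: near_eq_differentiable (near_eq _ _ x fg Ux) (df x Ux).
apply: IH (Cf a) => x; rewrite inE => Ux.
by apply: near_eq_derive; exact: near_eq.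
Qed.

Lemma differentiable_component (R : realType) (n r : nat)
    (phi : 'rV[R]_n -> 'rV[R]_r) (g : 'I_r) (x : 'rV[R]_n) :
  differentiable phi x -> differentiable (component phi g) x.
Proof.
move=> dphi.
exact: (differentiable_comp dphi (differentiable_coord (phi x) 0 g)).
Qed.

Lemma partial_component (R : realType) (n r : nat)
    (phi : 'rV[R]_n -> 'rV[R]_r) (g : 'I_r) (a : 'I_n) (x : 'rV[R]_n) :
  differentiable phi x ->
  partial a (component phi g) x = component (partial a phi) g x.
Proof.
move=> dphi; rewrite /component /partial derive_mx ?mxE//.
exact: diff_derivable.
Qed.

Lemma Ck_on_component (R : realType) (n r : nat) (k : nat)
    (U : set 'rV[R]_n) (phi : 'rV[R]_n -> 'rV[R]_r) (g : 'I_r) :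
  open U -> Ck_on k U phi -> Ck_on k U (component phi g).
Proof.
move=> Uo; elim: k phi => [|k IH] phi /=.
  move=> cphi x Ux.
  exact: (continuous_comp (cphi x Ux) (@coord_continuous _ _ _ 0 g _)).
move=> [dphi Cphi]; split=> [x Ux|a].
  by apply: differentiable_component; exact: dphi.
apply: Ck_on_ext (IH _ (Cphi a)) => // x; rewrite inE => Ux.
by rewrite partial_component//; exact: dphi.
Qed.

(** * First order conditions *)

(** Fermat's rule, from its one variable form on the line through [x] directed
by [v]. *)
Lemma derive_local_min (R : realType) (n : nat) (f : 'rV[R]_n -> R)
    (x v : 'rV[R]_n) :
  (\forall y \near x, differentiable f y) ->
  (\forall y \near x, f x <= f y) -> 'D_v f x = 0.
Proof.
move=> df fx.
have [e /= e0 He] := (nbhs_ballP _ _).1 (filterI df fx).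
pose d := e / (`|v| + 1).
have v1 : 0 < `|v| + 1 by rewrite ltr_wpDl.
have d0 : 0 < d by rewrite divr_gt0.
have inB (t : R) : t \in `]- d, d[ -> ball x e (x + t *: v).
  rewrite in_itv/= => /andP[td dt].
  rewrite -ball_normE/= opprD addrA subrr sub0r normrN normrZ.
  have td' : `|t| < d by rewrite ltr_norml td dt.
  rewrite (@le_lt_trans _ _ (`|t| * (`|v| + 1)))//.
    by rewrite ler_wpM2l// lerDl.
  by rewrite -ltr_pdivlMr.
have dk (t : R) : t \in `]- d, d[ ->
    is_derive t 1 (fun s : R => f (x + s *: v)) ('D_v f (x + t *: v)).
  by move=> /inB/He[? _]; exact: is_derive_segment.
have c0 : 0 \in `]- d, d[ by rewrite in_itv/= oppr_lt0 d0.
have := @derive1_at_min R (fun s => f (x + s *: v)) (- d) d 0.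
move=> /(_ _ _ c0) H.
have [] := H.
- by rewrite ge0_cp// ltW.
- by move=> t /dk[].
- by move=> t /inB/He[_]; rewrite scale0r addr0.
move=> _; have [_ ->] := dk _ c0.
by rewrite scale0r addr0.
Qed.

(** The squared distance to [y], unlike the distance, is differentiable
everywhere, and it has the same minimisers. *)
Lemma normal_equation (R : realType) (n r : nat) (phi : 'rV[R]_n -> 'rV[R]_r)
    (x : 'rV[R]_n) (y : 'rV[R]_r) (b : 'I_n) :
  (\forall z \near x, differentiable phi z) ->
  (\forall z \near x, enorm (phi x - y) <= enorm (phi z - y)) ->
  \sum_(g < r) (phi x - y) 0 g * partial b (component phi g) x = 0.
Proof.
move=> dphi ymin.
pose F (g : 'I_r) (z : 'rV[R]_n) : R := component phi g z - y 0 g.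
have dF g z : differentiable phi z -> differentiable (F g) z.
  move=> dz; have ? := differentiable_component g dz.
  exact: differentiableB.
have dF2 g z : differentiable phi z -> differentiable (F g * F g) z.
  by move=> dz; apply: differentiableM; exact: dF.
have := @derive_local_min R n (\sum_(g < r) F g * F g) x (delta_mx 0 b).
have dx := nbhs_singleton dphi.
rewrite derive_sum => [|g]; last first.
  by apply: diff_derivable; exact: dF2.
rewrite (eq_bigr (fun g =>
    2 * ((phi x - y) 0 g * partial b (component phi g) x))); last first.
  move=> g _; rewrite deriveM; try (apply: diff_derivable; exact: dF).
  rewrite /F deriveB; [|exact/diff_derivable/differentiable_component|
    exact: derivable_cst].
  rewrite derive_cst subr0 /GRing.scale/= /component !mxE.
  by rewrite -/(component phi g) -/(partial b _ x); ring.
rewrite -mulr_sumr => H; apply/eqP.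
have : 2 * (\sum_(g < r) (phi x - y) 0 g * partial b (component phi g) x) == 0.
  apply/eqP/H.
    apply: filterS dphi => z dz.
    by apply: differentiable_sum => g; exact: dF2.
  apply: filterS ymin => z; rewrite -ler_sqr ?nnegrE ?sqrtr_ge0// !enorm_sqr.
  rewrite !fct_sumE; congr (_ <= _); apply: eq_bigr => g _.
    by rewrite /F /component !mxE.
  by rewrite /F /component !mxE.
by rewrite mulf_eq0 pnatr_eq0.
Qed.

(** * Linear algebra of the Gram matrix *)

Lemma diff_coord (R : realType) (n r : nat) (phi : 'rV[R]_n -> 'rV[R]_r)
    (x v : 'rV[R]_n) (g : 'I_r) :
  differentiable phi x ->
  ('d phi x v) 0 g = \sum_(b < n) v 0 b * partial b (component phi g) x.
Proof.
move=> dphi; rewrite -deriveE// derive_partial// summxE.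
by apply: eq_bigr => b _; rewrite mxE partial_component.
Qed.

(** [hmx] is the Gram matrix of the partial derivatives of [phi], which are
linearly independent at an immersion point. *)
Lemma hmx_unit (R : realType) (n r : nat) (phi : 'rV[R]_n -> 'rV[R]_r)
    (x : 'rV[R]_n) :
  differentiable phi x -> injective ('d phi x) -> hmx phi x \in unitmx.
Proof.
move=> dphi inj; rewrite -row_free_unit -kermx_eq0.
apply/rowV0P => v /sub_kermxP vh.
apply: inj; rewrite linear0; apply/rowP => g; rewrite [RHS]mxE.
have : \sum_(k < r) ('d phi x v) 0 k ^+ 2 = 0.
  transitivity ((v *m hmx phi x *m v^T) 0 0); last by rewrite vh mul0mx mxE.
  pose D k b := v 0 b * partial b (component phi k) x.
  transitivity (\sum_(k < r) \sum_(b < n) \sum_(c < n) D k c * D k b).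
    apply: eq_bigr => k _; rewrite diff_coord// expr2 mulr_sumr.
    by apply: eq_bigr => b _; rewrite mulr_suml.
  rewrite exchange_big mxE/=; apply: eq_bigr => b _.
  rewrite exchange_big !mxE mulr_suml/=; apply: eq_bigr => c _.
  rewrite !mxE mulr_sumr mulr_suml; apply: eq_bigr => k _.
  by rewrite /D; ring.
move=> /eqP; rewrite psumr_eq0 => [|k _]; last exact: sqr_ge0.
by move=> /allP/(_ g (mem_index_enum _)); rewrite sqrf_eq0 => /eqP.
Qed.

Lemma Pimx_gradient (R : realType) (n r : nat) (phi : 'rV[R]_n -> 'rV[R]_r)
    (x : 'rV[R]_n) (w : 'I_r -> R) (a : 'I_n) :
  \sum_(b < n) hinv phi x a b *
    (\sum_(g < r) w g * partial b (component phi g) x)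
  = \sum_(g < r) Pimx phi x a g * w g.
Proof.
under eq_bigr do rewrite mulr_sumr; rewrite exchange_big/=.
apply: eq_bigr => g _; rewrite !mxE mulr_suml; apply: eq_bigr => b _.
by ring.
Qed.

Definition partialmx (R : realType) (n r : nat)
    (phi : 'rV[R]_n -> 'rV[R]_r) (x : 'rV[R]_n) : 'M[R]_(r, n) :=
  \matrix_(g, b) partial b (component phi g) x.

Lemma hmx_mul (R : realType) (n r : nat) (phi : 'rV[R]_n -> 'rV[R]_r)
    (x : 'rV[R]_n) :
  hmx phi x = (partialmx phi x)^T *m partialmx phi x.
Proof.
by apply/matrixP => a b; rewrite !mxE; apply: eq_bigr => g _; rewrite !mxE.
Qed.

Lemma Pimx_mul (R : realType) (n r : nat) (phi : 'rV[R]_n -> 'rV[R]_r)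
    (x : 'rV[R]_n) :
  Pimx phi x = hinv phi x *m (partialmx phi x)^T.
Proof.
apply/matrixP => a g; rewrite !mxE; apply: eq_bigr => b _.
by rewrite !mxE mulrC.
Qed.

Lemma Pimx_partial (R : realType) (n r : nat) (phi : 'rV[R]_n -> 'rV[R]_r)
    (x : 'rV[R]_n) (u : 'I_n -> R) (a : 'I_n) :
  hmx phi x \in unitmx ->
  \sum_(g < r) Pimx phi x a g *
    (\sum_(c < n) u c * partial c (component phi g) x) = u a.
Proof.
move=> hU; have PJ : Pimx phi x *m partialmx phi x = 1%:M.
  by rewrite Pimx_mul -mulmxA -hmx_mul mulVmx.
have := congr1 (fun A : 'M[R]_n => (A *m \col_c u c) a 0) PJ.
rewrite mul1mx -mulmxA => E.
transitivity ((\col_c u c) a (0 : 'I_1)); last by rewrite mxE.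
rewrite -E mxE; apply: eq_bigr => g _; congr (_ * _).
by rewrite !mxE; apply: eq_bigr => c _; rewrite !mxE mulrC.
Qed.

(** [Pimx] is [hinv] times the transposed Jacobian matrix and [hmx], hence also
[hinv], is symmetric, so that contracting with [hmx] gives the Jacobian matrix
back. *)
Lemma Pimx_hmx (R : realType) (n r : nat) (phi : 'rV[R]_n -> 'rV[R]_r)
    (x : 'rV[R]_n) (v : 'I_n -> R) (g : 'I_r) :
  hmx phi x \in unitmx ->
  \sum_(a < n) \sum_(b < n) Pimx phi x a g * hmx phi x a b * v b
  = \sum_(c < n) v c * partial c (component phi g) x.
Proof.
move=> hU; have PJ : (Pimx phi x)^T *m hmx phi x = partialmx phi x.
  have hT : (hmx phi x)^T = hmx phi x by rewrite hmx_mul trmx_mul trmxK.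
  by rewrite Pimx_mul trmx_mul trmxK trmx_inv hT -mulmxA mulVmx// mulmx1.
rewrite exchange_big/=; apply: eq_bigr => b _.
have := congr1 (fun A : 'M[R]_(r, n) => A g b) PJ.
rewrite !mxE => <-; rewrite mulr_sumr; apply: eq_bigr => a _.
by rewrite !mxE mulrC.
Qed.

(** * Expansion of the normal equations *)

(** The part of degree two of the [b]-th normal equation
[sum_g (J_g u + H_g(u,u) / 2 - t_g) * (J_gb + H_gb u) = 0]. *)
Definition normal_quad (R : realType) (n r : nat) (J : 'I_r -> 'I_n -> R)
    (H : 'I_r -> 'I_n -> 'I_n -> R) (u : 'I_n -> R) (t : 'I_r -> R)
    (b : 'I_n) : R :=
  \sum_(g < r) (2^-1 * (\sum_(a < n) \sum_(c < n) u a * u c * H g a c) * J g b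
    + (\sum_(a < n) u a * J g a - t g) * \sum_(c < n) u c * H g b c).

Section normal_equation_expansion.
Context {R : realType} {n r m : nat} (p : 'rV[R]_m).
Variables (J : 'I_r -> 'I_n -> R) (H : 'I_r -> 'I_n -> 'I_n -> R).
Implicit Types (u v : 'rV[R]_m -> 'I_n -> R) (t : 'rV[R]_m -> 'I_r -> R).

Lemma vanishes_lin k u (c : 'I_n -> R) :
  (forall a, vanishes p k (fun y => u y a)) ->
  vanishes p k (fun y => \sum_(a < n) u y a * c a).
Proof.
move=> Hu; apply: vanishes_sum => a.
by apply: vanishes_ext (vanishesZ (c a) (Hu a)) => y; rewrite mulrC.
Qed.

Lemma vanishes_form k l u v (c : 'I_n -> 'I_n -> R) :
  (forall a, vanishes p k (fun y => u y a)) ->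
  (forall a, vanishes p l (fun y => v y a)) ->
  vanishes p (k + l) (fun y => \sum_(a < n) \sum_(b < n) u y a * v y b * c a b).
Proof.
move=> Hu Hv; apply: vanishes_sum => a; apply: vanishes_sum => b.
apply: vanishes_ext (vanishesZ (c a b) (vanishesM (Hu a) (Hv b))) => y.
by rewrite mulrC.
Qed.

Lemma vanishes_normal_quad u t b :
  (forall a, vanishes p 1 (fun y => u y a)) ->
  (forall g, vanishes p 1 (fun y => t y g)) ->
  vanishes p 2 (fun y => normal_quad J H (u y) (t y) b).
Proof.
move=> Hu Ht; apply: vanishes_sum => g; apply: vanishesD.
  apply: vanishes_ext (vanishesZ (2^-1 * J g b)
    (vanishes_form (H g) Hu Hu)) => y.
  by rewrite mulrAC.
apply: (vanishesM (k := 1) (l := 1)); last exact: vanishes_lin.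
by apply: vanishesB => //; exact: vanishes_lin.
Qed.

(** Both terms are products of two factors of order one, so an error of order
two in [u] costs an error of order three. *)
Lemma vanishes_normal_quadB u v t b :
  (forall a, vanishes p 1 (fun y => u y a)) ->
  (forall a, vanishes p 1 (fun y => v y a)) ->
  (forall g, vanishes p 1 (fun y => t y g)) ->
  (forall a, vanishes p 2 (fun y => u y a - v y a)) ->
  vanishes p 3 (fun y =>
    normal_quad J H (u y) (t y) b - normal_quad J H (v y) (t y) b).
Proof.
move=> Hu Hv Ht Huv.
under eq_fun do rewrite -sumrB.
apply: vanishes_sum => g.
pose d y a := u y a - v y a.
pose F (k z : 'rV[R]_m -> 'I_n -> R) y :=
  \sum_(a < n) \sum_(c < n) k y a * z y c * H g a c.
pose w (z : 'rV[R]_m -> 'I_n -> R) y := \sum_(a < n) z y a * J g a.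
pose s (z : 'rV[R]_m -> 'I_n -> R) y := \sum_(c < n) z y c * H g b c.
have dF : vanishes p 3 (fun y => F d u y + F v d y).
  apply: vanishesD; first exact: (vanishes_form (k := 2) (l := 1)).
  exact: (vanishes_form (k := 1) (l := 2)).
have dw : vanishes p 3 (fun y => w d y * s u y + (w v y - t y g) * s d y).
  apply: vanishesD.
    by apply: (vanishesM (k := 2) (l := 1)); exact: vanishes_lin.
  apply: (vanishesM (k := 1) (l := 2)); last exact: vanishes_lin.
  by apply: vanishesB => //; exact: vanishes_lin.
apply: vanishes_ext (vanishesD (vanishesZ (2^-1 * J g b) dF) dw) => y.
have FE : F d u y + F v d y = F u u y - F v v y.
  rewrite /F -sumrB -big_split; apply: eq_bigr => a _.
  rewrite -sumrB -big_split; apply: eq_bigr => c _ /=.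
  by rewrite /d; ring.
have wE : w d y = w u y - w v y.
  by rewrite /w -sumrB; apply: eq_bigr => a _; rewrite -mulrBl.
have sE : s d y = s u y - s v y.
  by rewrite /s -sumrB; apply: eq_bigr => a _; rewrite -mulrBl.
rewrite FE wE sE -/(F u u y) -/(F v v y) -/(w u y) -/(w v y).
rewrite -/(s u y) -/(s v y).
move: (F u u y) (F v v y) (w u y) (w v y) (s u y) (s v y) => *.
by ring.
Qed.

(** The products of error terms that the expansion of [E g * G g] leaves out
all have total order at least three. *)
Lemma normal_equation_expansion u t (E G : 'I_r -> 'rV[R]_m -> R) b :
  (forall a, vanishes p 1 (fun y => u y a)) ->
  (forall g, vanishes p 1 (fun y => t y g)) ->
  (forall g, vanishes p 3 (fun y => E g y - (\sum_(a < n) u y a * J g a - t y g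
     + 2^-1 * \sum_(a < n) \sum_(c < n) u y a * u y c * H g a c))) ->
  (forall g, vanishes p 2 (fun y => G g y - (J g b
     + \sum_(c < n) u y c * H g b c))) ->
  (\forall y \near p, \sum_(g < r) E g y * G g y = 0) ->
  vanishes p 3 (fun y =>
    \sum_(g < r) (\sum_(a < n) u y a * J g a - t y g) * J g b
    + normal_quad J H (u y) (t y) b).
Proof.
move=> Hu Ht HE HG EG0.
pose w g y := \sum_(a < n) u y a * J g a - t y g.
pose q g y := 2^-1 * \sum_(a < n) \sum_(c < n) u y a * u y c * H g a c.
pose s g y := \sum_(c < n) u y c * H g b c.
pose rE g y := E g y - (w g y + q g y).
pose rG g y := G g y - (J g b + s g y).
have Hw g : vanishes p 1 (w g).
  by apply: vanishesB => //; exact: vanishes_lin.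
have Hq g : vanishes p 2 (q g).
  by apply: vanishesZ; exact: (vanishes_form (k := 1) (l := 1)).
have Hs g : vanishes p 1 (s g) by exact: vanishes_lin.
have HE1 g : vanishes p 1 (E g).
  apply: vanishes_ext (vanishesD (vanishesD (Hw g) (vanishesW _ (Hq g)))
    (vanishesW _ (HE g))) => // y.
  by rewrite [RHS]addrC subrK.
have err : vanishes p 3 (fun y => - \sum_(g < r)
    (q g y * s g y + (rE g y * J g b + rE g y * s g y) + E g y * rG g y)).
  apply: vanishesN; apply: vanishes_sum => g.
  apply: vanishesD; last exact: (vanishesM (HE1 g) (HG g)).
  apply: vanishesD; first exact: (vanishesM (Hq g) (Hs g)).
  apply: vanishesD.
    exact: (vanishesM (HE g) (vanishes_cst p (J g b))).
  exact: (vanishesW _ (vanishesM (HE g) (Hs g))).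
apply: vanishes_near err; apply: filterS EG0 => y EGy.
rewrite -[RHS]add0r -[X in _ = X + _]EGy -sumrB /normal_quad -big_split.
apply: eq_bigr => g _ /=.
rewrite -/(w g y) -/(s g y) -/(q g y) /rE /rG.
move: (E g y) (G g y) (w g y) (s g y) (q g y) => *.
by ring.
Qed.

End normal_equation_expansion.

(** The second order part of the solution of the normal equations, with
[u = Pi t] substituted: each block of sums is a product of the contractions
[v = Pi t], [w = J v] and [s = d2phi v]. *)
Lemma normal_quad_Pimx (R : realType) (n r : nat)
    (phi : 'rV[R]_n -> 'rV[R]_r) (x : 'rV[R]_n) (t : 'I_r -> R) (a : 'I_n)
    (d2phi : 'I_r -> 'I_n -> 'I_n -> R) :
  hmx phi x \in unitmx ->
  let Pi := Pimx phi x in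
  let h := hmx phi x in
  let h' := hinv phi x in
  - (\sum_(b < n) h' a b *
      normal_quad (fun g c => partial c (component phi g) x) d2phi
        (fun al => \sum_(g < r) Pi al g * t g) t b) =
  - (2^-1 * (\sum_(g < r) \sum_(al < n) \sum_(be < n)
              \sum_(de < r) \sum_(ep < r)
        d2phi g al be * Pi a g * Pi al de * Pi be ep * t de * t ep))
    + \sum_(g < r) \sum_(al < n) \sum_(be < n) \sum_(de < r)
        d2phi g al be * Pi be de * h' a al * t g * t de
    - \sum_(g < r) \sum_(al < n) \sum_(be < n)
      \sum_(de < r) \sum_(ep < r) \sum_(et < n) \sum_(ze < n)
        d2phi g al be * Pi be ep * Pi et g * Pi ze de * h et ze
        * h' a al * t de * t ep.
Proof.
move=> hU Pi h h'.
pose v al := \sum_(g < r) Pi al g * t g.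
pose J g c := partial c (component phi g) x.
pose q g := \sum_(al < n) \sum_(be < n) v al * v be * d2phi g al be.
pose s g b := \sum_(c < n) v c * d2phi g b c.
pose w g := \sum_(c < n) v c * J g c.
have E1 : \sum_(g < r) \sum_(al < n) \sum_(be < n) \sum_(de < r) \sum_(ep < r)
    d2phi g al be * Pi a g * Pi al de * Pi be ep * t de * t ep
    = \sum_(g < r) Pi a g * q g.
  apply: eq_bigr => g _; rewrite mulr_sumr; apply: eq_bigr => al _.
  rewrite mulr_sumr; apply: eq_bigr => be _.
  rewrite /v big_distrlr/= mulr_suml mulr_sumr; apply: eq_bigr => de _.
  by rewrite mulr_suml mulr_sumr; apply: eq_bigr => ep _; ring.
have E2 : \sum_(g < r) \sum_(al < n) \sum_(be < n) \sum_(de < r)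
    d2phi g al be * Pi be de * h' a al * t g * t de
    = \sum_(g < r) \sum_(b < n) h' a b * (t g * s g b).
  apply: eq_bigr => g _; apply: eq_bigr => al _.
  rewrite !mulr_sumr; apply: eq_bigr => be _.
  rewrite /v mulr_suml !mulr_sumr; apply: eq_bigr => de _.
  by ring.
have E3 : \sum_(g < r) \sum_(al < n) \sum_(be < n)
      \sum_(de < r) \sum_(ep < r) \sum_(et < n) \sum_(ze < n)
        d2phi g al be * Pi be ep * Pi et g * Pi ze de * h et ze
        * h' a al * t de * t ep
    = \sum_(g < r) \sum_(b < n) h' a b * (w g * s g b).
  apply: eq_bigr => g _; apply: eq_bigr => al _.
  rewrite !mulr_sumr; apply: eq_bigr => be _.
  rewrite /w -Pimx_hmx//.
  transitivity (\sum_(et < n) \sum_(ze < n) \sum_(de < r) \sum_(ep < r)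
    d2phi g al be * Pi be ep * Pi et g * Pi ze de * h et ze
        * h' a al * t de * t ep).
    rewrite (eq_bigr (fun de => \sum_(et < n) \sum_(ep < r) \sum_(ze < n)
      d2phi g al be * Pi be ep * Pi et g * Pi ze de * h et ze
        * h' a al * t de * t ep)) => [|de _]; last by rewrite exchange_big.
    rewrite exchange_big/=; apply: eq_bigr => et _.
    rewrite (eq_bigr (fun de => \sum_(ze < n) \sum_(ep < r)
      d2phi g al be * Pi be ep * Pi et g * Pi ze de * h et ze
        * h' a al * t de * t ep)) => [|de _]; last by rewrite exchange_big.
    by rewrite exchange_big.
  rewrite !mulr_suml mulr_sumr; apply: eq_bigr => et _.
  rewrite !mulr_suml mulr_sumr; apply: eq_bigr => ze _.
  rewrite -mulrA big_distrlr/= !mulr_sumr; apply: eq_bigr => de _.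
  rewrite !mulr_sumr; apply: eq_bigr => ep _.
  by rewrite -/Pi -/h; ring.
have E4 : \sum_(b < n) h' a b * normal_quad J d2phi v t b =
    2^-1 * \sum_(g < r) Pi a g * q g
    + \sum_(g < r) \sum_(b < n) h' a b * ((w g - t g) * s g b).
  rewrite (eq_bigr (fun b => \sum_(g < r) (h' a b * (2^-1 * q g * J g b)
      + h' a b * ((w g - t g) * s g b)))); last first.
    by move=> b _; rewrite mulr_sumr; apply: eq_bigr => g _; rewrite mulrDr.
  rewrite exchange_big mulr_sumr -big_split/=; apply: eq_bigr => g _.
  rewrite big_split/=; congr (_ + _).
  move: (q g) => Q.
  rewrite [Pi a g]mxE mulr_suml mulr_sumr; apply: eq_bigr => b _.
  by rewrite -/(J g b) -/h'; ring.
rewrite -/v -/J E1 E2 E3 E4 opprD -addrA; congr (_ + _).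
rewrite -sumrB -sumrN; apply: eq_bigr => g _.
rewrite -sumrB -sumrN; apply: eq_bigr => b _.
by ring.
Qed.

(** * Reduction to the parameter domain *)

(** An immersion is bounded below near [x0]: [Pimx] is a left inverse of the
differential, and the remainder is absorbed. *)
Lemma immersion_lower_bound (R : realType) (n r : nat)
    (phi : 'rV[R]_n -> 'rV[R]_r) (x0 : 'rV[R]_n) :
  differentiable phi x0 -> injective ('d phi x0) ->
  exists2 c, 0 < c & \forall x \near x0, `|x - x0| <= c * `|phi x - phi x0|.
Proof.
move=> dphi inj; have hU := hmx_unit dphi inj.
pose K := 1 + \sum_(a < n) \sum_(g < r) `|Pimx phi x0 a g|.
have K0 : 0 < K by rewrite ltr_pwDl// sumr_ge0// => a _; rewrite sumr_ge0.
have PdE u a : \sum_(g < r) Pimx phi x0 a g * ('d phi x0 u) 0 g = u 0 a.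
  rewrite -(Pimx_partial (fun c => u 0 c) a hU).
  by apply: eq_bigr => g _; rewrite diff_coord.
have Kd u : `|u| <= K * `|'d phi x0 u|.
  apply: normr_coords_le => [|a]; first by rewrite mulr_ge0// ltW.
  rewrite -PdE (le_trans (ler_norm_sum _ _ _))//.
  rewrite /K mulrDl mul1r ler_wpDl// mulr_suml (bigD1 a)//= ler_wpDr//.
    by rewrite sumr_ge0// => b _; rewrite mulr_ge0// sumr_ge0.
  rewrite mulr_suml ler_sum// => g _.
  by rewrite normrM ler_wpM2l// normr_coord_le.
(* this error in the differential leaves [`|h| / 2] to be absorbed *)
have e0 : 0 < (2 * K)^-1 by rewrite invr_gt0 mulr_gt0.
have /eqaddoP/(_ _ e0) := diff_locally dphi.
rewrite /= => Hd; exists (2 * K); first by rewrite mulr_gt0.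
rewrite (near_shift 0) /=; apply: filterS Hd => h.
rewrite subr0 /= addrK !fctE/= => Hd.
have := Kd h; set d := 'd phi x0 h in Hd *.
have : `|d| <= `|phi (h + x0) - phi x0| + (2 * K)^-1 * `|h|.
  rewrite -[d](subKr (phi (h + x0) - phi x0)) (le_trans (ler_normB _ _))//.
  by rewrite lerD2l -addrA -opprD.
move=> H1 /le_trans/(_ (ler_wpM2l (ltW K0) H1)).
rewrite mulrDr (_ : K * (_ * _) = `|h| / 2); last by field; rewrite gt_eqF.
by lra.
Qed.

(** Since [y0] competes with [P y], the triangle inequality bounds the Euclidean
distance from [P y] to [y0] by twice that from [y]. The factor [Num.sqrt r%:R]
comes from the passage to the sup norm. *)
Lemma metric_projection_lipschitz (R : realType) (r : nat)
    (M V : set 'rV[R]_r) (P : 'rV[R]_r -> 'rV[R]_r) (y0 : 'rV[R]_r) :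
  nbhs y0 V -> metric_projection_on M V P -> M y0 ->
  vanishes y0 1 (fun y => `|P y - y0|).
Proof.
move=> nV projP My0; apply/vanishesP; exists (Num.sqrt r%:R + 1).
  by rewrite ltr_wpDl// sqrtr_ge0.
apply: filterS nV => y Vy; have [_ Py] := projP y Vy.
have Py0 : enorm (P y - y) <= enorm (y0 - y).
  by have [<-//|y0P] := eqVneq y0 (P y); exact/ltW/Py.
rewrite normr_id expr1 mulrDl mul1r -[P y - y0](subrKA y).
rewrite (le_trans (ler_normD _ _))// lerD2r.
rewrite (le_trans (normr_le_enorm _))// (le_trans Py0)//.
by rewrite (le_trans (enorm_le_normr _))// distrC.
Qed.

(** Continuity of the inverse chart comes first, as the lower bound on the
immersion is only available once the parameter is known to be close to
[x0]. *)
Lemma embedded_projection (R : realType) (n r : nat) (U : set 'rV[R]_n)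
    (phi : 'rV[R]_n -> 'rV[R]_r) (x0 : 'rV[R]_n) (V : set 'rV[R]_r)
    (Pis : 'rV[R]_r -> 'rV[R]_r) :
  U x0 -> embedding_on U phi -> nbhs (phi x0) V ->
  metric_projection_on (phi @` U) V Pis ->
  (\forall y \near phi x0,
    U (pinv U phi (Pis y)) /\ phi (pinv U phi (Pis y)) = Pis y) /\
  vanishes (phi x0) 1 (fun y => `|pinv U phi (Pis y) - x0|).
Proof.
move=> Ux0 [smooth_phi immersion_phi inj_phi pinv_cont] nV projP.
have Mx0 : (phi @` U) (phi x0) by exists x0.
have pinvE x : U x -> pinv U phi (phi x) = x.
  by move=> Ux; rewrite pinvKV// inE.
have PisU y : V y ->
    U (pinv U phi (Pis y)) /\ phi (pinv U phi (Pis y)) = Pis y.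
  by move=> Vy; have [[x Ux <-] _] := projP y Vy; rewrite pinvE.
split; first exact: filterS nV.
have lipP := metric_projection_lipschitz nV projP Mx0.
have dphi : differentiable phi x0 by have [] := smooth_phi 1%N => /(_ x0 Ux0).
have [c c0 Hc] := immersion_lower_bound dphi (immersion_phi x0 Ux0).
have xcvg : pinv U phi (Pis y) @[y --> phi x0] --> x0.
  have Pcvg := vanishes_cvg lipP.
  move=> A; rewrite -{1}(pinvE _ Ux0) => /(pinv_cont (phi x0)) HA.
  have /Pcvg : within (phi @` U) (nbhs (phi x0)) (pinv U phi @^-1` A).
    by rewrite nbhs_subspace_in.
  apply: filterS2 nV => y Vy /=; apply.
  by have [] := projP y Vy.
have /vanishesP[C C0 HC] := lipP.
apply/vanishesP; exists (c * C); first exact: mulr_gt0.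
have H3 := xcvg _ Hc.
apply: filterS3 nV HC H3 => y Vy HCy /=; have [_ ->] := PisU y Vy.
rewrite normr_id => /le_trans; apply.
by rewrite -mulrA ler_wpM2l ?(ltW c0)// -[leLHS]normr_id.
Qed.

(** * The second order expansion *)

Theorem proposition4 (R : realType) (n r : nat)
  (U : set 'rV[R]_n) (phi : 'rV[R]_n -> 'rV[R]_r)
  (x0 : 'rV[R]_n) (y0 : 'rV[R]_r)
  (V : set 'rV[R]_r) (Pis : 'rV[R]_r -> 'rV[R]_r)
  (Uopen : open U) (Ux0 : U x0)
  (phi_emb : embedding_on U phi) (phix0 : phi x0 = y0)
  (nbhsV : nbhs y0 V) (Pis_proj : metric_projection_on (phi @` U) V Pis)
  (a : 'I_n) :
  let h := hmx phi x0 in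
  let h' := hinv phi x0 in
  let Pi := Pimx phi x0 in
  let d2phi (g : 'I_r) (al be : 'I_n) :=
    partial al (partial be (component phi g)) x0 in
  let tPis (y : 'rV[R]_r) := pinv U phi (Pis y) in
  let jet2 (t : 'rV[R]_r) : R :=
    x0 0 a + \sum_(al < r) Pi a al * t 0 al
    - 2^-1 * (\sum_(g < r) \sum_(al < n) \sum_(be < n)
              \sum_(de < r) \sum_(ep < r)
        d2phi g al be * Pi a g * Pi al de * Pi be ep * t 0 de * t 0 ep)
    + \sum_(g < r) \sum_(al < n) \sum_(be < n) \sum_(de < r)
        d2phi g al be * Pi be de * h' a al * t 0 g * t 0 de
    - \sum_(g < r) \sum_(al < n) \sum_(be < n)
      \sum_(de < r) \sum_(ep < r) \sum_(et < n) \sum_(ze < n)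
        d2phi g al be * Pi be ep * Pi et g * Pi ze de * h et ze
        * h' a al * t 0 de * t 0 ep in
  (fun y : 'rV[R]_r => tPis y 0 a) =
    (fun y => jet2 (y - y0)) +O_y0 (fun y => enorm (y - y0) ^+ 3).
Proof.
move=> h h' Pi d2phi tPis jet2.
subst y0; set y0 := phi x0 in nbhsV jet2 *.
have [smooth_phi immersion_phi _ _] := phi_emb.
have [tPisU tPis1] := embedded_projection Ux0 phi_emb nbhsV Pis_proj.
rewrite -/tPis in tPisU tPis1.
have U_near x : U x -> \forall z \near x, U z.
  by move=> Ux; exact: open_nbhs_nbhs.
have dphi x : U x -> differentiable phi x.
  by move=> Ux; have [] := smooth_phi 1%N => /(_ x Ux).
have hU : h \in unitmx.
  by apply: hmx_unit; [exact: dphi | exact: immersion_phi].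
have C3 g : Ck_on 3 U (component phi g) by exact: Ck_on_component.
have d1 g x : U x -> differentiable (component phi g) x.
  by case: (C3 g) => d _; exact: d.
have d2 g b x : U x -> differentiable (partial b (component phi g)) x.
  by case: (C3 g) => _ /(_ b)[d _]; exact: d.
have d3 g b c x : U x ->
    differentiable (partial c (partial b (component phi g))) x.
  by case: (C3 g) => _ /(_ b)[_ /(_ c)[d _]]; exact: d.
have sym g b c : d2phi g b c = d2phi g c b.
  apply: schwarz; [|exact: d2|exact: d2].
  by apply: filterS (U_near _ Ux0) => x; exact: d1.
pose J g b := partial b (component phi g) x0.
pose u (y : 'rV[R]_r) (b : 'I_n) := (tPis y - x0) 0 b.
pose t (y : 'rV[R]_r) (g : 'I_r) := (y - y0) 0 g.
pose v (y : 'rV[R]_r) (b : 'I_n) := \sum_(g < r) Pi b g * t y g.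
have u1 b : vanishes y0 1 (fun y => u y b).
  exact: (vanishes_comp tPis1 (vanishes_coord x0 b)).
have t1 g : vanishes y0 1 (fun y => t y g) by exact: vanishes_coord.
have v1 b : vanishes y0 1 (fun y => v y b).
  by apply: vanishes_sum => g; exact: vanishesZ.
(* the order of [b] and [c] in [d2phi g b c] is opposite to that in the
   derivative [partial c (partial b _)] given by Taylor's formula *)
have normal b : vanishes y0 3 (fun y =>
    \sum_(g < r) (\sum_(c < n) u y c * J g c - t y g) * J g b
    + normal_quad J d2phi (u y) (t y) b).
  apply: (@normal_equation_expansion _ _ _ _ _ _ _ _ _
    (fun g y => (phi (tPis y) - y) 0 g)
    (fun g y => partial b (component phi g) (tPis y))) => //.
  - move=> g; have nd1 : \forall x \near x0, differentiable (component phi g) x.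
      by apply: filterS (U_near _ Ux0) => x; exact: d1.
    have nd2 c : \forall x \near x0,
        differentiable (partial c (component phi g)) x.
      by apply: filterS (U_near _ Ux0) => x; exact: d2.
    have := vanishes_comp tPis1
      (taylor2 nd1 nd2 (fun c e => d3 g c e x0 Ux0)).
    apply: vanishes_ext => y /=.
    have symE : \sum_(c < n) \sum_(e < n) u y c * u y e * d2phi g c e =
        \sum_(c < n) \sum_(e < n) (tPis y - x0) 0 c * (tPis y - x0) 0 e *
          partial e (partial c (component phi g)) x0.
      by apply: eq_bigr => c _; apply: eq_bigr => e _; rewrite sym.
    have shift (p q s S1 S2 S2' : R) : S2 = S2' ->
        p - s - (S1 - (s - q) + 2^-1 * S2) = p - q - (S1 + 2^-1 * S2').
      by move=> ->; ring.
    have eE : (phi (tPis y) - y) 0 g = component phi g (tPis y) - y 0 g.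
      by rewrite !mxE.
    have tE : t y g = y 0 g - component phi g x0 by rewrite /t !mxE.
    by rewrite eE tE; exact: shift symE.
  - move=> g; have nd2 : \forall x \near x0,
        differentiable (partial b (component phi g)) x.
      by apply: filterS (U_near _ Ux0) => x; exact: d2.
    have := vanishes_comp tPis1
      (taylor1 nd2 (fun e => d3 g b e x0 Ux0)).
    apply: vanishes_ext => y /=.
    have symE : \sum_(c < n) u y c * d2phi g b c =
        \sum_(c < n) (tPis y - x0) 0 c *
          partial c (partial b (component phi g)) x0.
      by apply: eq_bigr => c _; rewrite sym.
    have shift (p q S1 S2 : R) : S1 = S2 -> p - (q + S1) = p - q - S2.
      by move=> ->; ring.
    exact: shift symE.
  apply: filterS2 nbhsV tPisU => y Vy [Uy phiy].
  apply: normal_equation.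
    by apply: filterS (U_near _ Uy) => z; exact: dphi.
  apply: filterS (U_near _ Uy) => z Uz; rewrite phiy.
  have [_ Py] := Pis_proj y Vy.
  have [->//|zP] := eqVneq (phi z) (Pis y).
  by apply/ltW/Py => //; exists z.
pose Q w y b' := \sum_(b < n) h' b' b * normal_quad J d2phi (w y) (t y) b.
(* multiplication by [h'] isolates [u] in the linear part *)
have solved b' : vanishes y0 3 (fun y => u y b' - v y b' + Q u y b').
  apply: vanishes_ext (vanishes_sum (fun b => vanishesZ (h' b' b) (normal b))).
  move=> y; under [RHS]eq_bigr do rewrite mulrDr.
  rewrite big_split; congr (_ + _).
  rewrite (Pimx_gradient phi x0 (fun g => \sum_(c < n) u y c * J g c - t y g)).
  under eq_bigr do rewrite mulrBr.
  by rewrite sumrB Pimx_partial.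
have Q2 b' : vanishes y0 2 (fun y => Q u y b').
  by apply: vanishes_sum => b; apply: vanishesZ; exact: vanishes_normal_quad.
have uv2 b' : vanishes y0 2 (fun y => u y b' - v y b').
  apply: vanishes_ext (vanishesB (vanishesW _ (solved b')) (Q2 b')) => // y.
  by rewrite addrK.
(* by [uv2], [u] may be replaced by [v = Pi t] in the quadratic part *)
have QB : vanishes y0 3 (fun y => Q u y a - Q v y a).
  under eq_fun do rewrite -sumrB.
  apply: vanishes_sum => b.
  apply: vanishes_ext (vanishesZ (h' a b)
    (vanishes_normal_quadB J d2phi b u1 v1 t1 uv2)) => y.
  by rewrite mulrBr.
have jetE y : jet2 (y - y0) = x0 0 a + v y a - Q v y a.
  have := normal_quad_Pimx (t y) a d2phi hU.
  rewrite -/(Q v y a) => E.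
  rewrite /jet2 -[in RHS]addrA [- Q v y a]E /v.
  by rewrite !addrA.
have key : vanishes y0 3 (fun y => tPis y 0 a - jet2 (y - y0)).
  apply: vanishes_ext (vanishesB (solved a) QB) => y.
  rewrite jetE (_ : tPis y 0 a = u y a + x0 0 a); last by rewrite /u !mxE subrK.
  move: (u y a) (v y a) (Q u y a) (Q v y a) (x0 0 a) => *.
  by ring.
have /vanishesP[C C0 HC] := key.
apply/eqaddOP/eqOP/eqO_exP; exists C => //.
apply: filterS HC => y /le_trans; apply.
rewrite ler_wpM2l ?(ltW C0)// normrX lerXn2r ?nnegrE//.
by rewrite ger0_norm ?sqrtr_ge0// normr_le_enorm.
Qed.
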